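(* Let $k\ge2$ and let $H=(V,E)$ be a simple, countable, $k$-uniform hypergraph with countably infinite edge set. Consider the conditions: (1) For every labeling $\phi$ of $E$ by $\mathbb{N}$ there is an infinite increasing $(k-1)$-branching tree in $H$. (2) $H$ has property $C_2$, i.e. there is a set $V'\subseteq V$ such that every $v\in V'$ lies in infinitely many edges $e\in E$ with $|V'\cap e|\ge2$. (3) For every labeling $\phi$ of $E$ by $\mathbb{N}$ there is an infinite increasing path in $H$. Then (1) implies (2), and (2) implies (3).
   Context: A hypergraph is simple if any two distinct vertices lie in at most one common edge. A labeling of $E$ by $\mathbb{N}$ is a bijection $\phi:E\to\mathbb{N}$. An infinite (loose) path is a sequence of distinct edges $e_1,e_2,\dots$ such that consecutive edges share exactly one vertex, these shared vertices are distinct, and non-consecutive edges are disjoint; it is increasing if $\phi(e_1)<\phi(e_2)<\cdots$. The infinite $(k-1)$-branching tree is the unique (up to isomorphism) $k$-uniform hypergraph with a distinguished root vertex in which every pair of vertices is connected by a unique loose path, the root has degree $1$ and every other vertex has degree $2$. For an edge $e$ of this tree, $t(e)$ is the number of edges on the path from $e$ to the root (so $t(e)=1$ for the edge containing the root). An infinite increasing $(k-1)$-branching tree in $H$ is a subhypergraph of $H$ isomorphic to the infinite $(k-1)$-branching tree such that for any two of its edges $e_1,e_2$ with $t(e_1)<t(e_2)$ we have $\phi(e_1)<\phi(e_2)$.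
   Formalization: In property C_2 the set V' is required to be nonempty; with V' empty, (2) would hold for every H and (2) implies (3) would fail, e.g. for infinitely many pairwise disjoint edges. *)

(* Defs.v *)
From HB Require Import structures.
From mathcomp Require Import all_boot finmap.
From mathcomp Require Import boolp classical_sets functions cardinality.

Set Implicit Arguments.
Unset Strict Implicit.
Unset Printing Implicit Defensive.

Local Open Scope card_scope.
Local Open Scope classical_set_scope.

Record hypergraph (V : choiceType) := Hypergraph {
  verts : set V;
  edges : set {fset V};
  edges_sub : forall e, edges e -> [set` e] `<=` verts
}.

Section Hypergraphs.
Context {V : choiceType}.
Implicit Types (H T : hypergraph V) (phi : {fset V} -> nat) (u v r : V).
Implicit Types (e f : {fset V}).

Definition simple_hypergraph H :=
  forall u v, verts H u -> verts H v -> u <> v ->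
  forall e f, edges H e -> edges H f ->
    u \in e -> v \in e -> u \in f -> v \in f -> e = f.

Definition uniform (k : nat) H := forall e, edges H e -> #|` e| = k.

Definition incident_edges H v : set {fset V} := [set e | edges H e /\ v \in e].

Definition has_degree H v (d : nat) := incident_edges H v #= `I_d.

Definition subhypergraph T H := verts T `<=` verts H /\ edges T `<=` edges H.

(* The values of phi outside edges H are irrelevant. *)
Definition labeling H phi := set_bij (edges H) [set: nat] phi.

(* A loose path whose edges are the p i for i in I, where I is an initial
   segment `I_n of nat (finite paths) or all of nat (infinite paths). Since
   consecutive edges share exactly one vertex, distinctness of the shared
   vertices is expressed as distinctness of the intersections. *)
Definition loose_path_on H (I : set nat) (p : nat -> {fset V}) :=
  [/\ forall i, I i -> edges H (p i),
      set_inj I p,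
      forall i, I i -> I i.+1 -> #|` (p i `&` p i.+1)%fset| = 1,
      set_inj [set i | I i /\ I i.+1] (fun i => (p i `&` p i.+1)%fset)
    & forall i j, I i -> I j -> i.+1 < j -> (p i `&` p j = fset0)%fset].

Definition infinite_path H (p : nat -> {fset V}) := loose_path_on H [set: nat] p.

Definition finite_path H (s : seq {fset V}) :=
  s <> [::] /\ loose_path_on H `I_(size s) (nth fset0 s).

Definition starts_at (s : seq {fset V}) u :=
  forall i, i < size s -> (u \in nth fset0 s i) = (i == 0).

Definition ends_at (s : seq {fset V}) v :=
  forall i, i < size s -> (v \in nth fset0 s i) = (i == (size s).-1).

(* The end vertices lie in no inner edge; otherwise dropping an end edge would
   give another path between the same two vertices. *)
Definition path_between H u v (s : seq {fset V}) :=
  [/\ finite_path H s, starts_at s u & ends_at s v].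

(* These conditions determine the infinite (k-1)-branching tree with root r up
   to isomorphism, so a hypergraph is isomorphic to it iff it satisfies them. *)
Definition branching_tree (k : nat) T r :=
  [/\ uniform k T,
      verts T r,
      forall u v, verts T u -> verts T v -> u <> v ->
        exists! s, path_between T u v s,
      has_degree T r 1
    & forall v, verts T v -> v <> r -> has_degree T v 2].

(* tree_level T r e n says t(e) = n; in a tree each edge has exactly one
   level. *)
Definition tree_level T r e (n : nat) :=
  exists s, [/\ finite_path T s, head fset0 s = e, ends_at s r & size s = n].

Definition increasing_tree (k : nat) H phi T r :=
  [/\ subhypergraph T H,
      branching_tree k T r
    & forall e f m n, edges T e -> edges T f ->
        tree_level T r e m -> tree_level T r f n -> m < n -> phi e < phi f].

Definition increasing_path H phi (p : nat -> {fset V}) :=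
  infinite_path H p /\ (forall i, phi (p i) < phi (p i.+1)).

(* W must be nonempty: W = set0 would make the property hold for every H. *)
Definition property_C2 H :=
  exists W : set V,
    [/\ W `<=` verts H,
        W !=set0
      & forall v, W v ->
          infinite_set
            [set e | incident_edges H v e /\ `I_2 #<= W `&` [set` e]]].

End Hypergraphs.

(* Main.v *)
(** (2) => (3): greedily leave the current edge through a vertex [v] of the set
    [W] witnessing C2; by simplicity only finitely many edges at [v] meet the
    earlier edges outside [v] or have too small a label.

    (1) => (2): if C2 fails, removing one by one a vertex that lies in finitely
    many edges with a second remaining vertex empties [H]; the removal order is
    a well-order in which every vertex is the maximum of all but finitely many
    of its edges. Hence there is [b : V -> nat] with finite fibres that grows by
    at most one in total along two consecutive upward steps. Write [mx e] for
    the maximum of [e], [mn e] for a vertex of minimal [b] among the others, and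
    call [e] good if [b (mx e) <= b (mn e)]. Label edges by increasing
    [b (mn e)], then bad before good, then by decreasing [mx e]. In an
    increasing tree follow the branch which leaves each edge [e] through [mn e],
    or through [mx e] if it was entered at [mn e]. Along it a good edge is never
    followed by a bad one and, as long as the edges stay good (or stay bad),
    [mx e] never increases and drops at least every second step: this
    contradicts the well-order. *)

Require Import Defs.
From HB Require Import structures.
From mathcomp Require Import all_boot finmap.
From mathcomp Require Import boolp classical_sets functions cardinality.

Set Implicit Arguments.
Unset Strict Implicit.
Unset Printing Implicit Defensive.

Local Open Scope classical_set_scope.
Local Open Scope card_scope.

(** * Well-orders by transfinite removal *)

Section Tower.
Context {T : Type} (c : set T -> T).
Implicit Types (A B M : set T) (F : set (set T)).

(* The stages of the transfinite process removing c A from A at each step;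
   the empty intersection makes the full set its first stage. *)
Inductive tower : set T -> Prop :=
| tower_remove A : tower A -> tower (A `\ c A)
| tower_bigcap F : (forall A, F A -> tower A) -> tower (\bigcap_(A in F) A).

Lemma tower_total A B : tower A -> tower B -> A `<=` B \/ B `<=` A.
Proof.
move=> tA; elim: tA B => {A}[A tA IHA|F tF IHF] B tB; last first.
  have [[A FA AB]|noF] := pselect (exists2 A, F A & A `<=` B).
    by left=> x Fx; exact: AB (Fx _ FA).
  right=> x Bx A FA; have [AB|] := IHF A FA B tB; last exact.
  by case: noF; exists A.
(* This stronger dichotomy says that no stage lies strictly between [A] and the stage after it, and
   it survives induction on [B]. *)
suff [AB|] : A `<=` B \/ B `<=` A `\ c A.
- by left=> x [/AB].
- by right.
elim: tB => {B}[B tB [AB|BA]|F tF IHF]; first 1 last.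
- by right=> x [/BA].
- have [[B FB BA]|noF] := pselect (exists2 B, F B & B `<=` A `\ c A).
    by right=> x Fx; exact: BA (Fx _ FB).
  left=> x Ax B FB; have [|BA] := IHF B FB; first exact.
  by case: noF; exists B.
have [|BA] := IHA _ (tower_remove tB); first by left.
have [AcB|nAcB] := pselect (A (c B)); last first.
  by left=> x Ax; split; [exact: AB | move=> /= xc; apply: nAcB; rewrite -xc].
right; suff -> : A = B by [].
rewrite eqEsubset; split=> // x Bx.
by have [->//|xc] := pselect (x = c B); apply: BA.
Qed.

Definition stage M : set T := \bigcap_(A in [set A | tower A /\ M `<=` A]) A.

Lemma tower_stage M : tower (stage M).
Proof. by apply: tower_bigcap => A []. Qed.

Lemma sub_stage M : M `<=` stage M.
Proof. by move=> x Mx A [_]; exact. Qed.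

Lemma stage_sub M A : tower A -> M `<=` A -> stage M `<=` A.
Proof. by move=> tA MA x; apply. Qed.

(** Otherwise removing the chosen element would leave a smaller stage that still contains [M]. *)
Lemma stage_choice M : stage M (c (stage M)) -> M (c (stage M)).
Proof.
move=> Sc; apply: contrapT => nMc.
have MS : M `<=` stage M `\ c (stage M).
  by move=> x Mx; split; [exact: sub_stage | move=> /= xc; apply: nMc; rewrite -xc].
by have [_ /(_ erefl)] := stage_sub (tower_remove (tower_stage M)) MS Sc.
Qed.

End Tower.

Lemma elimination_order (T : Type) (D : set T) (P : T -> set T -> Prop) :
  (forall W, W `<=` D -> W !=set0 -> exists2 v, W v & P v W) ->
  exists lt : T -> T -> Prop,
    [/\ (forall u, ~ lt u u),
        (forall u v w, lt u v -> lt v w -> lt u w),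
        (forall u v, D u -> D v -> u <> v -> lt u v \/ lt v u),
        (forall A, A `<=` D -> A !=set0 ->
           exists2 m, A m & forall x, A x -> ~ lt x m)
      & forall v, D v ->
          exists2 W, P v W & W v /\ forall u, D u -> lt v u -> W u].
Proof.
move=> elimP; have [D0|/set0P[x0 Dx0]] := eqVneq D set0.
  exists (fun _ _ => False); rewrite D0; split=> // [_ //|A A0 [x /A0]] //.
have /choice[c cP] W : exists v, (W `&` D) !=set0 -> (W `&` D) v /\ P v (W `&` D).
  have [WD|] := pselect ((W `&` D) !=set0); last by exists x0.
  by have [v ? ?] := elimP _ (@subIsetr _ W D) WD; exists v.
(* The last stage still containing [v]: for [v] in [D] the element removed from it is [v] itself, so
   strict inclusion of these stages is the order of removal. *)
pose st v := stage c [set v].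
have tst v : tower c (st v) by exact: tower_stage.
have stv v : st v v by exact: sub_stage.
have cst v : D v -> c (st v) = v.
  move=> Dv; have [] := cP (st v); first by exists v; split.
  by move=> -[/stage_choice].
exists (fun u v => st v `<=` st u /\ ~ st u `<=` st v); split.
- by move=> u [].
- move=> u v w [vu uv] [wv vw]; split; first exact: subset_trans wv vu.
  by move=> uw; apply: vw; exact: subset_trans uw.
- move=> u v Du Dv uv.
  have [uv1|uv1] := pselect (st u `<=` st v).
    have [vu|vu] := pselect (st v `<=` st u); last by right.
    by case: uv; rewrite -(cst u)// -(cst v)//; congr c; rewrite eqEsubset.
  by have [//|] := tower_total (tst u) (tst v); left.
- move=> A AD [a Aa].
  (* The minimum of [A] is the element removed from the least stage containing [A]. *)
  have [|[cS _] _] := cP (stage c A).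
    by exists a; split; [exact: sub_stage | exact: AD].
  have Ac := stage_choice cS.
  exists (c (stage c A)) => // x Ax [mx xm]; apply: xm.
  apply: (@subset_trans _ (stage c A)).
    by apply: stage_sub; [exact: tower_stage | move=> _ ->; exact: sub_stage].
  apply: stage_sub => // y Ay.
  have [->//|ym] := pselect (y = c (stage c A)).
  have [H|H] := tower_total (tower_remove (tower_stage c A)) (tst (c (stage c A))).
    by apply: H; split=> //; exact: sub_stage.
  by have [_ []] := H _ (stv _).
- move=> v Dv; exists (st v `&` D).
    by have [] := cP (st v); [exists v; split | move=> _; rewrite cst].
  by split=> // u Du [uv _]; split=> //; apply: uv.
Qed.

(** * Labelings and ranks with values in the natural numbers *)

Lemma order_labeling (T : choiceType) (E : set T) (lt : T -> T -> Prop) :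
  infinite_set E -> (forall e, ~ lt e e) ->
  (forall e f g, lt e f -> lt f g -> lt e g) ->
  (forall e f, E e -> E f -> e <> f -> lt e f \/ lt f e) ->
  (forall e, E e -> finite_set [set f | E f /\ lt f e]) ->
  exists phi : T -> nat, set_bij E [set: nat] phi /\
    forall e f, E e -> E f -> phi e < phi f -> lt e f.
Proof.
move=> Einf irr tr tot fin.
pose pr e := fset_set [set f | E f /\ lt f e].
have prP e f : E e -> (f \in pr e) = `[< E f /\ lt f e >].
  move=> Ee; rewrite /pr in_fset_set; last exact: fin.
  by apply/idP/asboolP; rewrite inE.
(* The label of [e] is its number of predecessors. *)
pose phi e := #|` pr e|.
have mono e f : E e -> E f -> lt e f -> phi e < phi f.
  move=> Ee Ef ef; apply: fproper_ltn_card; rewrite fproperE; apply/andP; split.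
    apply/fsubsetP => g; rewrite !prP// => /asboolP[Eg ge]; apply/asboolP.
    by split=> //; exact: tr ge ef.
  apply/negP => /fsubsetP /(_ e); rewrite !prP//.
  by move=> /(_ (introT (asboolP _) (conj Ee ef))) /asboolP[_ /irr].
have inj : set_inj E phi.
  move=> e f /[!inE] Ee Ef eqphi; apply: contrapT => /(tot e f Ee Ef).
  by move=> -[/mono|/mono] /(_ _ _)/[!eqphi]/[!ltnn] H; have := H _ _; auto.
exists phi; split; last first.
  move=> e f Ee Ef lt_ef; have [ef|/(tot _ _ Ee Ef)[//|/mono]] := pselect (e = f).
    by rewrite ef ltnn in lt_ef.
  by move=> /(_ Ef Ee); rewrite ltnNge ltnW.
split=> //; move=> n _ /=.
have [e Ee ne] : exists2 e, E e & n <= phi e.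
  apply: contrapT => no; apply: Einf.
  rewrite (eq_finite_set (B := phi @` E)); last first.
    by rewrite card_esym// inj_card_eq.
  apply: sub_finite_set (finite_II n) => _ [e Ee <-] /=.
  by rewrite ltnNge; apply/negP => ne; apply: no; exists e.
have [->|neq] := eqVneq n (phi e); first by exists e.
(* The [phi e] predecessors of [e] have distinct labels below [phi e], so by counting they take all
   of these values. *)
have: phi @` [set f | E f /\ lt f e] = `I_(phi e).
  apply: fset_set_inj; [exact/finite_image/fin | exact: finite_II |].
  apply/eqP; rewrite eqEfcard; apply/andP; split.
    rewrite -fset_set_sub; [|exact/finite_image/fin|exact: finite_II].
    by move=> _ [f [Ef fe] <-] /=; exact: mono.
  rewrite (card_fset_set (card_eqxx _)) fset_set_image; last exact: fin.
  rewrite card_in_imfset// => f g; rewrite !prP// => /asboolP[Ef _] /asboolP[Eg _].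
  by apply: inj; rewrite inE.
move/seteqP => [_ /(_ n)] []; first by rewrite /= ltn_neqAle neq.
by move=> f [Ef _] <-; exists f.
Qed.

(** Exhaust [D] by finite sets [G n], each step adding the element of index [n] and all
    [R]-successors of what is already there; [b v] is the first [n] with [v] in [G n]. *)
Lemma slow_growth (T : Type) (D : set T) (R : T -> T -> Prop) :
  countable D -> (forall u, D u -> finite_set [set v | D v /\ R u v]) ->
  exists b : T -> nat, (forall n, finite_set [set v | D v /\ b v <= n]) /\
    forall u v, D u -> D v -> R u v -> b v <= (b u).+1.
Proof.
move=> /countable_injP[idx idx_inj] finR.
pose G := nat_rect (fun=> set T) set0 (fun n A =>
  A `|` [set v | D v /\ idx v = n] `|` \bigcup_(u in A) [set v | D v /\ R u v]).
have GS n : G n.+1 = G n `|` [set v | D v /\ idx v = n] `|`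
    \bigcup_(u in G n) [set v | D v /\ R u v] by [].
have GD n : G n `<=` D.
  by elim: n => [//|n IH] x; rewrite GS => -[[/IH//|[]//]|[u _ []//]].
have Gfin n : finite_set (G n).
  elim: n => [//|n IH]; rewrite GS !finite_setU; split; first split=> //.
    have [[v [Dv iv]]|no] := pselect (exists v, D v /\ idx v = n).
      apply: sub_finite_set (finite_set1 v) => w [Dw iw].
      by apply: idx_inj; rewrite ?inE// iw.
    by apply: sub_finite_set (finite_set0 T) => w Dw; apply: no; exists w.
  by apply: bigcup_finite => // u /GD; exact: finR.
have Gmono m n : m <= n -> G m `<=` G n.
  elim: n => [|n IH]; first by rewrite leqn0 => /eqP ->.
  rewrite leq_eqVlt ltnS => /orP[/eqP->//|/IH mn] x Gx.
  by rewrite GS; left; left; exact: mn.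
have /choice[b bP] v : exists n, D v -> G n v /\ forall m, G m v -> n <= m.
  have [Dv|] := pselect (D v); last by exists 0.
  have exG : exists n, `[< G n v >].
    by exists (idx v).+1; apply/asboolP; rewrite GS; left; right.
  exists (ex_minn exG) => _; case: ex_minnP => n /asboolP Gn nmin.
  by split=> // m Gm; apply/nmin/asboolP.
exists b; split=> [n|u v Du Dv uv].
  apply: sub_finite_set (Gfin n) => v [Dv bn].
  exact: Gmono bn _ (proj1 (bP v Dv)).
apply: (proj2 (bP v Dv)); rewrite GS; right; exists u => //.
exact: (proj1 (bP u Du)).
Qed.

Lemma seq_greatest (T : eqType) (lt : T -> T -> Prop) (s : seq T) :
  (forall u v w, lt u v -> lt v w -> lt u w) ->
  {in s &, forall u v, u <> v -> lt u v \/ lt v u} ->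
  s <> [::] -> exists2 t, t \in s & {in s, forall u, u <> t -> lt u t}.
Proof.
move=> tr; elim: s => [//|x s IH] tot _.
have [->|/eqP s0] := eqVneq s [::].
  by exists x; rewrite ?mem_head// => u; rewrite inE => /eqP.
have [|t ts tmax] := IH _ s0.
  by move=> u v us vs; apply: tot; rewrite inE ?us ?vs orbT.
have txs : t \in x :: s by rewrite inE ts orbT.
have [xt|/(tot _ _ (mem_head x s) txs)[xt|tx]] := pselect (x = t).
- by subst t; exists x => // u; rewrite inE => /orP[/eqP//|/tmax].
- by exists t => // u; rewrite inE => /orP[/eqP->|/tmax].
- exists x; rewrite ?mem_head// => u; rewrite inE => /orP[/eqP//|us _].
  have [->//|ut] := pselect (u = t).
  exact: tr (tmax _ us ut) tx.
Qed.

Lemma card_ge2P (T : choiceType) (A : set T) (x y : T) :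
  A x -> A y -> x <> y -> `I_2 #<= A.
Proof.
move=> Ax Ay /eqP xy.
have : [set` [fset x; y]%fset] #= `I_2 by apply/card_eq_fsetP; rewrite cardfs2 xy.
rewrite card_eq_le => /andP[_ /card_le_trans]; apply.
by apply: subset_card_le => z; rewrite /= !inE => /orP[/eqP->|/eqP->].
Qed.

Lemma card_ge2_neq (T : choiceType) (A : set T) (x : T) :
  `I_2 #<= A -> exists2 y, A y & y <> x.
Proof.
move=> A2; apply: contrapT => no.
suff : `I_2 #<= `I_1 by rewrite card_le_II.
rewrite -(card_le_eqr (@card_set1 T x)).
apply: card_le_trans A2 (subset_card_le _) => y Ay /=.
by apply: contrapT => yx; apply: no; exists y.
Qed.

Lemma cardfs_gt1_neq (T : choiceType) (A : {fset T}) (x : T) :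
  1 < #|` A| -> exists2 y, y \in A & y <> x.
Proof.
move=> A2; have : 0 < #|` (A `\ x)%fset|.
  by move: A2; rewrite (cardfsD1 x); case: (x \in A) => //; exact: ltnW.
rewrite cardfs_gt0 => /fset0Pn[y /fsetD1P[/eqP yx Ay]].
by exists y.
Qed.

(** * A labeling without increasing trees when C2 fails *)

Section DescendingLabeling.
Context {V : choiceType} (H : hypergraph V).

(** An edge at [v] with a later vertex still has two remaining vertices when [v] is removed, and [v]
    was chosen to have finitely many such edges. *)
Lemma elimination_order_of_not_C2 : ~ property_C2 H ->
  exists lt : V -> V -> Prop,
    [/\ (forall u, ~ lt u u),
        (forall u v w, lt u v -> lt v w -> lt u w),
        (forall u v, verts H u -> verts H v -> u <> v -> lt u v \/ lt v u),
        (forall A, A `<=` verts H -> A !=set0 ->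
           exists2 m, A m & forall x, A x -> ~ lt x m)
      & forall v, verts H v ->
          finite_set [set e | incident_edges H v e /\ exists2 u, u \in e & lt v u]].
Proof.
move=> nC2.
have [|lt [irr tr tot wf fin]] := @elimination_order V (verts H) (fun v W =>
    finite_set [set e | incident_edges H v e /\ `I_2 #<= W `&` [set` e]]).
  move=> W WH W0; apply: contrapT => no; apply: nC2; exists W; split=> // v Wv.
  by move=> fin; apply: no; exists v.
exists lt; split=> // v Hv; have [W finW [Wv Wlt]] := fin v Hv.
apply: sub_finite_set finW => e [[He ve] [u ue vu]]; split=> //.
apply: (@card_ge2P _ _ v u); first by split.
  by split=> //; apply: Wlt => //; exact: edges_sub He u ue.
by move=> uv; rewrite uv in vu; exact: irr vu.
Qed.

Lemma exists_argmin (T : choiceType) (s : seq T) (b : T -> nat) x :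
  x \in s -> exists2 m, m \in s & {in s, forall y, b m <= b y}.
Proof.
move=> xs; have exb : exists n, `[< exists2 m, m \in s & b m = n >].
  by exists (b x); apply/asboolP; exists x.
have [_ /asboolP[m ms <-] nmin] := ex_minnP exb.
by exists m => // y ys; apply/nmin/asboolP; exists y.
Qed.

(* [drop e f]: the pair (bad before good, [mx]) strictly decreases from [e] to
   [f]. The branch leaving every edge through [mn], or through [mx] when it was
   entered at [mn], drops at least every second step. *)
Lemma descending_labeling (k : nat) :
  1 < k -> simple_hypergraph H -> countable (verts H) -> uniform k H ->
  edges H #= [set: nat] -> ~ property_C2 H ->
  exists (phi : {fset V} -> nat) (mx mn : {fset V} -> V)
         (drop : {fset V} -> {fset V} -> Prop),
    [/\ labeling H phi,
        (forall A, A `<=` edges H -> A !=set0 ->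
           exists2 m, A m & forall e, A e -> ~ drop m e),
        (forall e, edges H e -> [/\ mx e \in e, mn e \in e & mn e <> mx e]),
        (forall e f, edges H e -> edges H f -> phi e < phi f ->
           mn e \in f -> drop e f)
      & (forall e f, edges H e -> edges H f -> phi e < phi f -> mx e \in f ->
           drop e f \/ mx f = mx e /\ forall g, drop f g -> drop e g)].
Proof.
move=> k2 simpleH countV unifH cardE nC2.
have [lt [irr tr tot wf finup]] := elimination_order_of_not_C2 nC2.
have Hv e u : edges H e -> u \in e -> verts H u.
  by move=> He ue; exact: edges_sub He u ue.
have infE : infinite_set (edges H).
  by apply/infiniteP; move: cardE; rewrite card_eq_le => /andP[].
have [e0 He0] : edges H !=set0.
  exact: infinite_setN0 infE.
pose up u v := lt u v /\ exists e, [/\ edges H e, u \in e & v \in e].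
have finup1 u : verts H u -> finite_set [set v | verts H v /\ up u v].
  move=> Hu; apply: sub_finite_set
    (bigcup_finite (finup u Hu) (F := fun e => [set` e]) _).
    by move=> v [_ [uv [e [He ue ve]]]]; exists e => //; split=> //; exists v.
  by move=> e _; exact: finite_fset.
(* Bounding [b] along one and two upward steps at once makes it impossible for
   [b] to increase twice in a row. *)
pose up2 u v := up u v \/ exists w, [/\ verts H w, up u w & up w v].
have [|b [finb bup]] := @slow_growth V (verts H) up2 countV.
  move=> u Hu; apply: (@sub_finite_set _ _ ([set v | verts H v /\ up u v] `|`
      \bigcup_(w in [set w | verts H w /\ up u w]) [set v | verts H v /\ up w v])).
    by move=> v [Vv [uv|[w [Hw uw wv]]]]; [left|right; exists w].
  rewrite finite_setU; split; first exact: finup1.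
  by apply: bigcup_finite => [|w [Hw _]]; exact: finup1.
have [v0 _] : exists v, v \in e0.
  by apply/fset0Pn; rewrite -cardfs_gt0 (unifH e0 He0) ltnW.
(* The first component is the [lt]-greatest vertex of [e], the second minimizes [b] among the
   others; [(v0, v0)] is a default for non-edges. *)
have /choice[mm mmP] e : exists mm : V * V, edges H e ->
    [/\ mm.1 \in e, {in e, forall u, u <> mm.1 -> lt u mm.1},
        mm.2 \in e, mm.2 <> mm.1 &
        {in e, forall u, u <> mm.1 -> b mm.2 <= b u}].
  have [He|] := pselect (edges H e); last by exists (v0, v0).
  have e2 : 1 < #|` e| by rewrite (unifH e He).
  have [||t te tmax] := @seq_greatest _ lt e tr.
  - by move=> u v ue ve; apply: tot; apply: Hv He _.
  - by move=> e0'; move: e2; rewrite e0'.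
  - have [x xe /eqP xt] := cardfs_gt1_neq t e2.
    have [|m] := @exists_argmin _ (enum_fset (e `\ t)%fset) b x.
      by apply/fsetD1P.
    move=> /fsetD1P[/eqP mt me] mmin; exists (t, m) => _; split=> //= u ue /eqP ut.
    by apply: mmin; apply/fsetD1P.
pose mx e := (mm e).1; pose mn e := (mm e).2.
pose B e := b (mn e); pose good e := b (mx e) <= B e.
(* Doubling makes room for one bit: keys compare by [B] first, and at equal [B] bad edges come
   before good ones. *)
pose key e := (B e).*2 + good e.
have [idx idx_inj] : exists idx : {fset V} -> nat, {in edges H &, injective idx}.
  by apply/countable_injP; move: cardE; rewrite card_eq_le => /andP[].
pose prec e f := key e < key f \/ key e = key f /\
  (lt (mx f) (mx e) \/ mx e = mx f /\ idx e < idx f).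
have [phi [phi_bij phi_prec]] : exists phi : {fset V} -> nat,
    set_bij (edges H) [set: nat] phi /\
    forall e f, edges H e -> edges H f -> phi e < phi f -> prec e f.
  apply: order_labeling.
  - exact: infE.
  - by move=> e [|[_ [/irr|[_]]]]; rewrite ?ltnn.
  - move=> e f g [ef|[ef fe]] [fg|[fg gf]].
    + by left; exact: ltn_trans ef fg.
    + by left; rewrite -fg.
    + by left; rewrite ef.
    + right; split; first by rewrite ef.
      case: fe gf => [fe|[fe i]] [gf|[gf j]].
      * by left; exact: tr gf fe.
      * by left; rewrite -gf.
      * by left; rewrite fe.
      * by right; split; [rewrite fe | exact: ltn_trans i j].
  - move=> e f He Hf ef; rewrite /prec.
    have [lt_ef|lt_fe|eq_k] := ltngtP (key e) (key f); [by left; left|by right; left|].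
    have [eq_m|neq_m] := pselect (mx e = mx f).
      have [lt_ef|lt_fe|/idx_inj] := ltngtP (idx e) (idx f).
      * by left; right; split=> //; right.
      * by right; right; split=> //; right.
      * by rewrite !inE => /(_ He Hf).
    have [me _ _ _ _] := mmP e He; have [mf _ _ _ _] := mmP f Hf.
    have [ef_m|fe_m] := tot _ _ (Hv _ _ He me) (Hv _ _ Hf mf) neq_m.
      by right; right; split=> //; left.
    by left; right; split=> //; left.
  (* If [f] precedes [e], then [b (mn f) <= key e] leaves finitely many choices for [mn f], and [f]
     is one of the finitely many edges at [mn f] with a later vertex, namely [mx f]. *)
  - move=> e He; apply: sub_finite_set (bigcup_finite (finb (key e)) (F := fun v =>
        [set f | incident_edges H v f /\ exists2 u, u \in f & lt v u]) _).
      move=> f [Hf fe]; have [mf mfmax nf nmf _] := mmP f Hf.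
      exists (mn f); last by split=> //; exists (mx f) => //; exact: mfmax.
      split; first exact: Hv _ _ Hf nf.
      have : key f <= key e by case: fe => [/ltnW|[->]].
      apply: leq_trans; rewrite /key -addnn -addnA; exact: leq_addr.
    by move=> v [Vv _]; exact: finup.
have precB e f : edges H e -> edges H f -> phi e < phi f -> B e <= B f /\
    (B e = B f -> good f /\ ~ good e \/
     (good e -> good f) /\ (lt (mx f) (mx e) \/ mx e = mx f)).
  move=> He Hf /(phi_prec _ _ He Hf); rewrite /prec /key.
  have [BB|BB|->] := ltngtP (B e) (B f).
  - by split=> // BB'; rewrite BB' ltnn in BB.
  - have ltk : (B f).*2 + good f < (B e).*2 + good e.
      apply: (@leq_trans (B f).+1.*2).
        by rewrite doubleS ltnS -addn1 leq_add2l; case: (good f).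
      by apply: leq_trans (leq_addr _ _); rewrite leq_double.
    by case=> [|[eq_k _]]; [rewrite ltnNge ltnW | rewrite eq_k ltnn in ltk].
  - move=> kef; split=> // _; move: kef; rewrite ltn_add2l.
    case=> [|[/addnI] + m].
      by case: (good e) (good f) => -[] //= _; left.
    case: (good e) (good f) => -[] //= _; right; split=> //.
    1,2: by case: m => [|[]]; [left|right].
pose drop e f := (good e -> good f) /\ (good f /\ ~ good e \/ lt (mx f) (mx e)).
exists phi, mx, mn, drop; split=> //.
- move=> A AE A0.
  (* A drop never leads from good to bad, so a good edge of least [mx] is minimal; if all edges of
     [A] are bad, any edge of least [mx] is. *)
  have [A0g|A0g] := pselect (exists2 e, A e & good e).
    have [||_ [m [Am gm] <-] mmin] := wf (mx @` [set e | A e /\ good e]).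
    + by move=> _ [e [/AE He _] <-]; have [me _ _ _ _] := mmP e He;
        exact: Hv _ _ He me.
    + by case: A0g => e Ae ge; exists (mx e), e.
    exists m => // e Ae [ge [[_ /(_ gm)//]|lt_em]].
    by apply: mmin lt_em; exists e => //; split=> //; exact: ge.
  have [||_ [m Am <-] mmin] := wf (mx @` A).
  + by move=> _ [e /AE He <-]; have [me _ _ _ _] := mmP e He;
        exact: Hv _ _ He me.
  + by case: A0 => e Ae; exists (mx e), e.
  exists m => // e Ae [_ [[ge _]|lt_em]]; first by apply: A0g; exists e.
  by apply: mmin lt_em; exists e.
- by move=> e /mmP[].
- move=> e f He Hf ef wf'; have [le_B eq_B] := precB e f He Hf ef.
  have [me emax ne nme emin] := mmP e He; have [mf fmax nf nmf fmin] := mmP f Hf.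
  (* If [mn e] is the maximum of [f], then [b (mx f) = B e <= B f]: [f] is good and its maximum is
     smaller than that of [e]. *)
  have [wm|wm] := pselect (mn e = mx f).
    have gf : good f by rewrite /good -wm.
    by split=> [//|]; right; rewrite -wm; exact: emax.
  (* Otherwise [mn e] is a candidate for [mn f], which gives [B f <= B e]. A common maximum would
     then be a second vertex shared by [e] and [f], against simplicity. *)
  have eqB : B e = B f by apply/eqP; rewrite eqn_leq le_B fmin.
  have [[gf nge]|[gef [lt_fe|eq_m]]] := eq_B eqB.
  + by split=> //; left.
  + by split=> //; right.
  suff eq_ef : e = f by rewrite eq_ef ltnn in ef.
  apply: (simpleH (mn e) (mx e)) => //; try exact: Hv He _.
  by rewrite eq_m.
- move=> e f He Hf ef tf; have [le_B eq_B] := precB e f He Hf ef.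
  have [me emax ne nme emin] := mmP e He; have [mf fmax nf nmf fmin] := mmP f Hf.
  have [tm|tm] := pselect (mx e = mx f).
    right; split=> // g [gfg fg].
    have gef : good e -> good f by rewrite /good -tm => /leq_trans; apply.
    split; first by move=> /gef/gfg.
    rewrite tm; case: fg => [[gg ngf]|]; last by right.
    by left; split=> // /gef.
  (* Here the maximum rises, which at equal [B] happens only from a bad edge to a good one. A good
     [e] would force equality through [B f <= b (mx e) <= B e]. *)
  have ltm : lt (mx e) (mx f) by exact: fmax.
  have le_Bt : B f <= b (mx e) by exact: fmin.
  have noteq : ~ (lt (mx f) (mx e) \/ mx e = mx f).
    by move=> [/(tr _ _ _ ltm)/irr|].
  left; have [ge|nge] := boolP (good e).
    have eqB : B e = B f by apply/eqP; rewrite eqn_leq le_B (leq_trans le_Bt ge).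
    by have [[_ /(_ ge)]|[_ /noteq]] := eq_B eqB.
  have gf : good f.
    have [eqB|neqB] := eqVneq (B e) (B f).
      by have [[]|[_ /noteq]] := eq_B eqB.
    have ltB : B e < B f by rewrite ltn_neqAle neqB.
    (* The two upward steps from [mn e] through [mx e] to [mx f] raise [b] by at most one in total,
       hence to at most [B f]. *)
    apply: leq_trans ltB; apply: bup; [exact: Hv He ne|exact: Hv Hf mf|right].
    exists (mx e); split; first exact: Hv He me.
    + by split; [exact: emax | exists e].
    + by split=> //; exists f.
  by split=> //; left; split=> //; exact/negP.
Qed.

End DescendingLabeling.

(** * Paths to the root of a branching tree *)

Section TreePaths.
Context {V : choiceType} (T : hypergraph V) (k : nat) (r : V).
Hypothesis T_simple : simple_hypergraph T.
Hypothesis T_tree : branching_tree k T r.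
Implicit Types (s : seq {fset V}) (e f : {fset V}) (x y p : V).

Lemma finite_path_take s j :
  j < size s -> finite_path T s -> finite_path T (take j.+1 s).
Proof.
move=> js [_ [sE sinj scap sshared sdisj]].
have sz : size (take j.+1 s) = j.+1 by rewrite size_takel.
have lts i : i < j.+1 -> i < size s by move=> /leq_trans; apply.
have nthE i : i < j.+1 -> nth fset0 (take j.+1 s) i = nth fset0 s i.
  by move=> ij; rewrite nth_take.
split; first by case: s js {sE sinj scap sshared sdisj sz lts nthE}.
rewrite sz; split.
- by move=> i /= ij; rewrite nthE//; apply: sE; exact: lts.
- move=> i i' /[!inE] ij i'j; rewrite !nthE//.
  by apply: sinj; rewrite inE; exact: lts.
- by move=> i /= ij ij1; rewrite !nthE//; apply: scap; exact: lts.
- move=> i i' /[!inE] -[/= ij ij1] [i'j i'j1]; rewrite !nthE//.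
  by apply: sshared; rewrite inE; split; exact: lts.
- by move=> i i' /= ij i'j; rewrite !nthE//; apply: sdisj; exact: lts.
Qed.

Lemma path_between_edge e x y :
  edges T e -> x \in e -> y \in e -> path_between T x y [:: e].
Proof.
move=> eT xe ye; split.
- split=> //; split=> /=.
  + by move=> [|].
  + by move=> [|i] [|j]; rewrite ?inE.
  + by move=> i _ /=.
  + by move=> i j; rewrite inE => -[].
  + by move=> [|i] [|j].
- by move=> [|i].
- by move=> [|i].
Qed.

(* p is the vertex through which the first edge of s is entered from the root
   (the root itself when s has a single edge). *)
Definition rooted_path s p :=
  [/\ finite_path T s, ends_at s r, p \in head fset0 s
    & forall x, x \in head fset0 s -> x <> p ->
        x <> r /\ forall j, 0 < j < size s -> x \notin nth fset0 s j].

Lemma root_edge : exists e, rooted_path [:: e] r.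
Proof.
have [_ rT _ deg1 _] := T_tree.
have [e [eT re]] : incident_edges T r !=set0.
  apply/set0P/negP => /eqP E; move: deg1; rewrite /has_degree E card_eq_sym card_eq0.
  by move=> /eqP/seteqP[/(_ 0) H _]; exact: H.
exists e; have [eP _ eE] := path_between_edge eT re re; split=> //= x _ xr.
by split=> // -[|j].
Qed.

(** Degree two at [x] provides a second edge [f]; uniqueness of paths keeps [f] away from the rest
    of [s]. *)
Lemma rooted_path_extend s p x :
  rooted_path s p -> x \in head fset0 s -> x <> p ->
  exists f, [/\ f <> head fset0 s, x \in f & rooted_path (f :: s) x].
Proof.
case: s => [[[]]//|e s] [path_s end_s /= pe esep] xe xp.
have [kT _ uniqT _ deg2] := T_tree.
have [xr xs] := esep x xe xp.
have [_ [sE sinj scap sshared sdisj]] := path_s.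
have eT : edges T e := sE 0 isT.
have inT f y : edges T f -> y \in f -> verts T y.
  by move=> fT yf; exact: edges_sub fT y yf.
have xT := inT _ _ eT xe.
have [f [[fT xf] fe]] : exists f, incident_edges T x f /\ f <> e.
  have : `I_2 #<= incident_edges T x.
    by have := deg2 x xT xr; rewrite /has_degree card_eq_le => /andP[].
  by move=> /(@card_ge2_neq _ _ e)[f xf fe]; exists f.
have fex y : y \in f -> y \in e -> y = x.
  move=> yf ye; apply: contrapT => yx; apply: fe.
  by apply: (T_simple (inT _ _ fT yf) xT yx).
(* The edge f closes no cycle: take the first edge of the path that it meets
   again, in a vertex y. *)
have disj j y : 0 < j < size (e :: s) -> y \in f -> y \notin nth fset0 (e :: s) j.
  elim/ltn_ind: j y => j IH y /andP[j0 js] yf; apply/negP => ys.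
  have xsj : x \notin nth fset0 (e :: s) j by apply: xs; rewrite j0.
  have xy : x <> y by move=> xy; rewrite xy ys in xsj.
  have sz : size (take j.+1 (e :: s)) = j.+1 by rewrite size_takel.
  have P1 : path_between T x y (take j.+1 (e :: s)).
    split; first exact: finite_path_take.
    - move=> i; rewrite sz => ij; rewrite nth_take//.
      case: i ij => [|i] ij; first by rewrite /= xe.
      by apply/negbTE; apply: xs; rewrite /= (leq_trans ij).
    - move=> i; rewrite sz => ij; rewrite nth_take// succnK.
      have [->|neq] := eqVneq i j; first exact: ys.
      have ltij : i < j by rewrite ltn_neqAle neq.
      case: i ij neq ltij => [|i] ij neq ltij.
        by apply/negP => /(fex _ yf) yx; apply: xy.
      by apply/negbTE; apply: IH => //; rewrite /= (leq_trans ij).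
  (* The prefix of the path and the single edge [f] both join [x] to [y], so uniqueness gives
     [e = f]. *)
  have [t [_ tuniq]] := uniqT x y xT (inT _ _ fT yf) xy.
  have := tuniq _ (path_between_edge fT xf yf); rewrite (tuniq _ P1) /=.
  by move=> [ef _]; apply: fe; rewrite ef.
have capfe : (f `&` e = [fset x])%fset.
  apply/fsetP => y; rewrite !inE; apply/andP/eqP => [[]|->]; last by [].
  exact: fex.
have fneq j : j < size (e :: s) -> f <> nth fset0 (e :: s) j.
  case: j => [//|j] js fs; have := disj j.+1 x js xf.
  by rewrite -fs xf.
exists f; split=> //.
have rf : r \notin f.
  apply/negP => rf; have := end_s (size s) (ltnSn _); rewrite /= eqxx.
  case: (posnP (size s)) => [->|s0].
    by move=> /= /(fex _ rf) /esym.
  by apply/negP; apply: disj; rewrite ?s0 /=.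
split=> //.
- split=> //; split.
  + by move=> [_|i] //=; apply: sE.
  + move=> [|i] [|j] //; rewrite !inE /= => i1 j1; first by move/(fneq _ j1).
    * by move/esym/(fneq _ i1).
    * by move=> ss; congr S; apply: sinj; rewrite ?inE.
  + move=> [_ _|i i1 i2] /=; last exact: scap.
    by rewrite capfe cardfs1.
  + have xcap i : i.+1 < size (e :: s) -> (f `&` e)%fset <>
        (nth fset0 (e :: s) i `&` nth fset0 (e :: s) i.+1)%fset.
      move=> i1 /fsetP/(_ x); rewrite capfe !inE eqxx => /esym/andP[_].
      by apply/negP/xs.
    move=> [|i] [|j] //; rewrite !inE /= => -[i1 i2] [j1 j2].
    * by move/(xcap _ j2).
    * by move/esym/(xcap _ i2).
    * by move=> ss; congr S; apply: sshared; rewrite ?inE.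
  + move=> [|i] [|j] //= i1 j1 ij.
      apply/fsetP => y; rewrite !inE; apply/negbTE/negP => /andP[yf].
      by apply/negP; apply: disj => //; apply/andP; split; [exact: ij | exact: j1].
    exact: sdisj.
- move=> [|i] /= i1; first exact/negbTE.
  by rewrite end_s.
- move=> y yf yx; split; first by move=> yr; rewrite yr (negbTE rf) in yf.
  move=> [|[|j]] //= j1; last exact: (disj j.+1).
  by apply/negP => /(fex _ yf).
Qed.

End TreePaths.

(** * Greedy construction of an increasing path from C2 *)

Section GreedyPath.
Context {V : choiceType} (H : hypergraph V).
Hypothesis H_simple : simple_hypergraph H.

(** Only finitely many edges have label at most [n], and by simplicity each vertex of [Y] other than
    [v] excludes at most one edge at [v]; infinitely many candidates cannot all be excluded. *)
Lemma greedy_edge (phi : {fset V} -> nat) (W : set V) (v : V) (Y : {fset V}) n :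
  labeling H phi ->
  infinite_set [set e | incident_edges H v e /\ `I_2 #<= W `&` [set` e]] ->
  exists e, [/\ incident_edges H v e, n < phi e,
    {in e, forall x, x \in Y -> x = v} & exists2 w, W w /\ w \in e & w <> v].
Proof.
move=> [_ phi_inj _] infW.
pose bad := [set e | edges H e /\ phi e <= n] `|`
  \bigcup_(u in [set` (Y `\ v)%fset]) [set e | incident_edges H v e /\ u \in e].
have badfin : finite_set bad.
  rewrite finite_setU; split.
    suff : phi @` [set e | edges H e /\ phi e <= n] `<=` `I_n.+1.
      move=> /sub_finite_set/(_ (finite_II _));
      rewrite -(eq_finite_set (A := [set e | edges H e /\ phi e <= n]))//.
      rewrite card_eq_sym; apply: inj_card_eq => e f /[!inE] -[He _] [Hf _].
      by apply: phi_inj; rewrite inE.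
    by move=> _ [e [_ en] <-].
  apply: bigcup_finite => [|u /fsetD1P[/eqP uv _]]; first exact: finite_fset.
  have [[e [[He ve] ue]]|no] := pselect (exists e, incident_edges H v e /\ u \in e).
    apply: sub_finite_set (finite_set1 e) => f [[Hf vf] uf].
    by apply: (H_simple (u := u) (v := v)) => //;
      [exact: edges_sub He _ ue | exact: edges_sub He _ ve].
  by apply: sub_finite_set (finite_set0 _) => f Hf; apply: no; exists f.
have [e [[[He ve] We] ngood]] := infinite_setN0 (infinite_setD infW badfin).
exists e; split=> //.
- by rewrite ltnNge; apply/negP => en; apply: ngood; left.
- move=> x xe xY; apply: contrapT => xv; apply: ngood; right.
  by exists x => //; apply/fsetD1P; split=> //; apply/eqP.
- by have [w [Ww we] wv] := card_ge2_neq v We; exists w.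
Qed.

Lemma increasing_path_of_C2 (phi : {fset V} -> nat) :
  property_C2 H -> labeling H phi ->
  exists p : nat -> {fset V}, increasing_path H phi p.
Proof.
move=> [W [_ [v0 Wv0] infW]] phiL.
(* A state (X, e, v): e is the current edge, v the vertex through which it will
   be left, and X the union of all earlier edges. *)
pose ok (st : {fset V} * {fset V} * V) :=
  let: (X, e, v) := st in [/\ edges H e, W v, v \in e & v \notin X].
(* The new edge meets the union of all edges so far exactly in the exit vertex, which yields every
   intersection condition of a loose path. *)
pose next (st st' : {fset V} * {fset V} * V) :=
  [/\ st'.1.1 = (st.1.1 `|` st.1.2)%fset, phi st.1.2 < phi st'.1.2
    & (st'.1.2 `&` (st.1.1 `|` st.1.2) = [fset st.2])%fset].
have /choice[step stepP] st : exists st', ok st -> ok st' /\ next st st'.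
  case: st => [[X e] v]; have [[He Wv ve vX]|] := pselect (ok (X, e, v)); last first.
    by exists (X, e, v).
  have [f [[Hf vf] ef fv [w [Ww wf] wv]]] :=
    greedy_edge (X `|` e)%fset (phi e) phiL (infW v Wv).
  exists ((X `|` e)%fset, f, w) => _; split.
    by split=> //; apply/negP => /(fv _ wf).
  split=> //=; apply/fsetP => x; rewrite in_fsetI in_fset1.
  apply/andP/eqP => [[xf /(fv _ xf)//]|->].
  by rewrite vf inE ve orbT.
have [e0 [[He0 v0e0] _ _ _]] := greedy_edge fset0 0 phiL (infW v0 Wv0).
pose st n := iter n step (fset0, e0, v0).
have stok n : ok (st n) by elim: n => [|n /stepP[]].
have stnext n : next (st n) (st n.+1) by have [] := stepP _ (stok n).
pose p n := (st n).1.2; pose X n := (st n).1.1; pose v n := (st n).2.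
have okP n : [/\ edges H (p n), W (v n), v n \in p n & v n \notin X n].
  by have := stok n; rewrite /ok /p /X /v; case: (st n) => [[]].
have phiS n : phi (p n) < phi (p n.+1) by have [] := stnext n.
have XS n : X n.+1 = (X n `|` p n)%fset by have [] := stnext n.
have capX n : (p n.+1 `&` X n.+1 = [fset v n])%fset.
  by rewrite XS; have [] := stnext n.
have pX m n : m < n -> (p m `<=` X n)%fset.
  elim: n => [//|n IH]; rewrite ltnS leq_eqVlt XS => /orP[/eqP->|/IH pm].
    exact: fsubsetUr.
  exact: fsubset_trans pm (fsubsetUl _ _).
have capS n : (p n `&` p n.+1 = [fset v n])%fset.
  apply/eqP; rewrite eqEfsubset; apply/andP; split.
    by rewrite -capX fsetIC fsetIS// pX.
  rewrite fsub1set inE; have [_ _ -> _] := okP n => /=.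
  have : v n \in [fset v n]%fset by rewrite inE.
  by rewrite -capX inE => /andP[].
have phi_mono : {homo phi \o p : m n / m < n}.
  by apply: homo_ltn => [n m l|n]; [exact: ltn_trans | exact: phiS].
exists p; split=> //; split.
- by move=> n _; have [] := okP n.
- move=> m n _ _ pmn; have [/phi_mono|/phi_mono|//] := ltngtP m n;
    by rewrite /= pmn ltnn.
- by move=> n _ _; rewrite capS cardfs1.
- have v_neq m n : m < n -> v m <> v n.
    move=> mn vmn; have [_ _ vpm _] := okP m; have [_ _ _] := okP n.
    by rewrite -vmn (fsubsetP (pX _ _ mn) _ vpm).
  move=> m n _ _; rewrite !capS => /fset1_inj.
  have [/v_neq//|/v_neq nm|//] := ltngtP m n; by move/esym.
(* A common vertex of [p m] and [p n.+1] would be [v n], which avoids [X n] and hence [p m]. *)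
- move=> m [//|n] _ _; rewrite ltnS => mn.
  apply/fsetP => x; rewrite !inE; apply/negbTE/negP => /andP[xm xn].
  have xv : x \in [fset v n]%fset.
    by rewrite -capX inE xn (fsubsetP (pX _ _ (leqW mn)) _ xm).
  have [_ _ _] := okP n; move: xv; rewrite inE => /eqP <-.
  by rewrite (fsubsetP (pX _ _ mn) _ xm).
Qed.

End GreedyPath.

(** * The two implications *)

Theorem theorem2p4 (V : choiceType) (k : nat) (H : hypergraph V)
    (hk : 2 <= k)
    (H_simple : simple_hypergraph H)
    (H_countable : countable (verts H))
    (H_uniform : uniform k H)
    (H_edges : edges H #= [set: nat]) :
  ((forall phi : {fset V} -> nat, labeling H phi ->
      exists (T : hypergraph V) (r : V), increasing_tree k H phi T r) ->
    property_C2 H) /\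
  (property_C2 H ->
    forall phi : {fset V} -> nat, labeling H phi ->
      exists p : nat -> {fset V}, increasing_path H phi p).
Proof.
split=> [trees|C2 phi phiL]; last exact: increasing_path_of_C2.
apply: contrapT => nC2.
have [phi [mx [mn [drop [phiL drop_wf mxmn drop_mn drop_mx]]]]] :=
  descending_labeling hk H_simple H_countable H_uniform H_edges nC2.
have [T [r [[TH_v TH] treeT phi_incr]]] := trees phi phiL.
have T_simple : simple_hypergraph T.
  by move=> u v /TH_v Hu /TH_v Hv uv e f /TH He /TH Hf; exact: H_simple.
have head_edge s p : rooted_path T r s p -> edges T (head fset0 s).
  by case: s => [[[]]//|e s] [[_ [sE _ _ _ _]] _ _ _]; exact: sE 0 isT.
have extend s p x : rooted_path T r s p -> x \in head fset0 s -> x <> p ->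
    exists f, [/\ edges H f, phi (head fset0 s) < phi f, x \in f
                & rooted_path T r (f :: s) x].
  move=> sp xs xp; have [f [_ xf fs]] := rooted_path_extend T_simple treeT sp xs xp.
  have [path_s end_s _ _] := sp; have [path_fs end_fs _ _] := fs.
  exists f; split=> //; first by apply: TH; exact: head_edge fs.
  apply: (phi_incr _ _ (size s) (size s).+1) => //.
  - exact: head_edge sp.
  - exact: head_edge fs.
  - by exists s.
  - by exists (f :: s).
(* Instead of following an infinite branch, take an edge reached from the root that has no drop to
   any other such edge, and produce one. *)
have [||_ [s [p sp] <-] smin] := drop_wf [set e | exists2 s,
    exists p, rooted_path T r s p & head fset0 s = e].
- by move=> _ [s [p /head_edge/TH He] <-].
- by have [e e_root] := root_edge treeT; exists e, [:: e] => //; exists r.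
have He : edges H (head fset0 s) := TH _ (head_edge _ _ sp).
have [mxe mne neq] := mxmn _ He.
have [pmn|pmn] := pselect (mn (head fset0 s) = p); last first.
  have [f [Hf ef xf fs]] := extend _ _ _ sp mne pmn.
  by apply: (smin f); [exists (f :: s) => //; eexists; exact: fs | exact: drop_mn].
(* The edge was entered at its [mn], so it is left through its [mx]. Unless this drops, [f] is
   entered at its own maximum and can be left through [mn f], which drops even from the original
   edge. *)
have [|f [Hf ef xf fs]] := extend _ _ _ sp mxe; first by rewrite -pmn => /esym.
have [ef_drop|[mxf drop_f]] := drop_mx _ _ He Hf ef xf.
  by apply: (smin f) => //; exists (f :: s) => //; eexists; exact: fs.
have [mxf_f mnf_f neqf] := mxmn _ Hf.
have [|g [Hg fg xg gs]] := extend _ _ _ fs mnf_f; first by rewrite -mxf.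
apply: (smin g); first by exists (g :: f :: s) => //; eexists; exact: gs.
by apply: drop_f; exact: drop_mn.
Qed.
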